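(* Let $\mathcal{A}=(a_i)_{i=1}^\infty$ be a non-decreasing sequence of positive integers and let $k$ be a positive integer. The sequence $(p_{\mathcal{A}}(n,k))_{n=1}^\infty$ is eventually log-concave (that is, $p_{\mathcal{A}}(n,k)^2>p_{\mathcal{A}}(n+1,k)\,p_{\mathcal{A}}(n-1,k)$ for all sufficiently large $n$) if and only if one of the following holds: (i) $k\geqslant 2$ and $a_1=\cdots=a_k=1$; or (ii) $k\geqslant 4$ and $\gcd A=1$ for all $(k-2)$-multisubsets $A$ of the multiset $\{a_1,a_2,\ldots,a_k\}$.
   Context: For a non-decreasing sequence $\mathcal{A}=(a_i)_{i=1}^\infty$ of positive integers, a positive integer $k$ and an integer $n\geqslant 0$, $p_{\mathcal{A}}(n,k)$ (the multicolor restricted partition function) denotes the number of partitions of $n$ with parts in the multiset $\{a_1,\ldots,a_k\}$, where equal entries $a_i=a_j$ with $i\neq j$ are regarded as distinct (differently colored) parts and the order of parts is irrelevant; equivalently $\sum_{n\geqslant 0}p_{\mathcal{A}}(n,k)x^n=\prod_{i=1}^k\frac{1}{1-x^{a_i}}$. A $j$-multisubset of $\{a_1,\ldots,a_k\}$ is a collection $\{a_{i_1},\ldots,a_{i_j}\}$ with $1\leqslant i_1<\cdots<i_j\leqslant k$ (distinct indices, possibly equal values). Log-concavity is understood with strict inequality. *)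

(* Defs.v *)
From mathcomp Require Import all_boot.

Set Implicit Arguments.
Unset Strict Implicit.
Unset Printing Implicit Defensive.

(* Sequences are indexed from 0: the parts a_1, ..., a_k are a 0, ..., a (k - 1).

   A partition of n is given by the multiplicity m i of each coloured part i;
   equal values at different indices thus count as different parts.  When all
   parts are positive a multiplicity is at most n, so that bounding it by n
   loses no partition. *)
Definition multicolor_partitions (a : nat -> nat) (n k : nat) :
    {set {ffun 'I_k -> 'I_n.+1}} :=
  [set m : {ffun 'I_k -> 'I_n.+1} | \sum_(i < k) m i * a i == n].

Definition multicolor_p (a : nat -> nat) (n k : nat) : nat :=
  #|multicolor_partitions a n k|.

(* The bound is [N < n] rather than [N <= n] so that n.-1 is never truncated. *)
Definition eventually_log_concave (u : nat -> nat) : Prop :=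
  exists N : nat, forall n : nat, N < n -> u n.+1 * u n.-1 < u n ^ 2.

(* A multisubset of the multiset {a_1, ..., a_k} is a set of indices. *)
Definition multisubset_gcd (a : nat -> nat) (k : nat) (A : {set 'I_k}) : nat :=
  \big[gcdn/0]_(i in A) a i.

(* Main.v *)
Require Import Defs.
From mathcomp Require Import all_boot all_order all_algebra all_field.
From mathcomp Require Import zify ring lra.

(** Let l be the list of the k parts, u n the number of partitions of n with
    parts in l, P the product of l and u_j the j-th forward difference of u.
    The identity

      u (n+1) ^ 2 - u (n+2) * u n = u_1 n ^ 2 - u_0 n * u_2 n

    reduces log-concavity to a comparison of the first three differences.

    The generating function of u has a pole of order k at 1, and at each
    primitive d-th root of unity a pole whose order m_d is the number of parts
    divisible by d.  Taking j differences lowers the pole at 1 to order k-j and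
    leaves the others alone.  If m_d < k-j for all d > 1, the pole at 1
    dominates, and u_j n ~ n^(k-1-j) / (P (k-1-j)!): this is
    [npart_diff_asymp].

    Sufficiency.  The gcd condition on (k-2)-multisubsets says that m_d <= k-3
    for all d > 1, so that the asymptotics hold for j = 0, 1, 2.  The leading
    coefficient of u_1 ^ 2 - u_0 u_2 is then positive ([npart_log_concave]).
    A list of k >= 3 ones is covered as well, since there m_d = 0.

    Necessity.  An eventually log-concave sequence of natural numbers is
    eventually strictly increasing: once it fails to increase it decreases
    forever.  If some d > 1 divided all parts except x, then u (n+x) - u n
    would count partitions of n+x into multiples of d, which is 0 for suitable
    n.  So every d > 1 misses at least two parts ([log_concave_two_ndvd]).
    Suppose that it misses exactly two, x and y, and let D be the gcd of the
    other parts.  The difference of u with steps x and y counts partitions into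
    multiples of D: it is supported on the multiples of D, so that its values
    there are D times as large as its mean growth.  But it is also a sum of
    x y values of u_2, and log-concavity bounds u_2 by u_1 ^ 2 / u_0, which is
    (k-1)/(k-2) times the mean growth of u_2.  Hence D (k-2) <= k-1
    ([log_concave_gcd]), so that k = 3 and D = 2.  For k = 3 every part greater
    than 1 can play the role of d, hence is 2, and only one part is even; but
    for the parts 1, 1, 2 one has u (2q+1) ^ 2 = u (2q) u (2q+2). *)

Set Implicit Arguments.
Unset Strict Implicit.
Unset Printing Implicit Defensive.

Import Order.TTheory GRing.Theory Num.Theory.

(** * Partitions with parts in a list *)

Fixpoint npart (l : seq nat) (n : nat) : nat :=
  if l is a :: l' then \sum_(j < n.+1 | j * a <= n) npart l' (n - j * a)
  else n == 0.

(** Together with [npartD] this is the recursion expressing that multiplying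
    the generating function of [a :: l] by 1 - x^a gives that of [l]. *)
Lemma npart_lt a l n : n < a -> npart (a :: l) n = npart l n.
Proof.
move=> lt_na /=; rewrite (bigD1 ord0) //= mul0n subn0 big1 ?addn0 // => j.
by case/andP=> le_jan; rewrite -val_eqE /=; move: le_jan; case: (val j) => // i; nia.
Qed.

(** The range of the multiplicity may be enlarged at will; a range independent
    of [n] is what the comparisons of two values of [npart] require. *)
Lemma npart_cons_nat N a l n : 0 < a -> n <= N ->
  npart (a :: l) n = \sum_(0 <= j < N.+1 | j * a <= n) npart l (n - j * a).
Proof.
move=> a0 le_nN /=.
rewrite -(big_mkord (fun j => j * a <= n) (fun j => npart l (n - j * a))).
rewrite [RHS](@big_cat_nat _ _ _ n.+1) //=.
rewrite [X in _ = _ + X]big_nat_cond [X in _ = _ + X]big1 ?addn0 // => j.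
by case/andP=> /andP[lt_nj _]; nia.
Qed.

Lemma npartD a l n : 0 < a ->
  npart (a :: l) (n + a) = npart (a :: l) n + npart l (n + a).
Proof.
move=> a0; rewrite (@npart_cons_nat (n + a).+1) //.
rewrite big_mkcond big_nat_recl // leq0n mul0n subn0 [LHS]addnC; congr (_ + _).
rewrite (@npart_cons_nat (n + a)) ?leq_addr // [RHS]big_mkcond /=.
by apply: eq_bigr => j _; rewrite mulSn addnC leq_add2r subnDr.
Qed.

(** The truncated geometric series stand in for 1 / (1 - x^a): truncation at
    [N] does not affect the coefficients up to [N]. *)
Lemma npart_coef (l : seq nat) (N n : nat) :
  all (leq 1) l -> n <= N ->
  ((\prod_(a <- l) \sum_(j < N.+1) 'X^(j * a))`_n = (npart l n)%:Z :> int)%R.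
Proof.
elim: l n => [|a l IHl] n.
  by move=> _ _; rewrite big_nil coef1 /=; case: (n == 0).
case/andP=> a0 l0 le_nN; rewrite big_cons mulr_suml coef_sum.
rewrite (npart_cons_nat _ a0 le_nN) big_mkord.
rewrite -natz natr_sum [RHS]big_mkcond /=; apply: eq_bigr => j _.
rewrite natz coefXnM ltnNge; case: leqP => //= le_jan.
by rewrite IHl // (leq_trans (leq_subr _ _)).
Qed.

Lemma npart_perm l1 l2 n : all (leq 1) l1 -> perm_eq l1 l2 -> npart l1 n = npart l2 n.
Proof.
move=> l0 l12; apply/eqP; rewrite -eqz_nat; apply/eqP.
rewrite -!(@npart_coef _ n) //; first by rewrite (perm_big _ l12).
by rewrite -(perm_all _ l12).
Qed.

(** Expanding the product of truncated geometric series gives one monomial per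
    choice of multiplicities. *)
Lemma multicolor_pE (a : nat -> nat) n k : (forall i, 0 < a i) ->
  multicolor_p a n k = npart [seq a i | i <- iota 0 k] n.
Proof.
move=> a0; apply/eqP; rewrite -(@eqr_nat int); apply/eqP.
rewrite [RHS]natz -(@npart_coef _ n) //; last first.
  by apply/allP=> _ /mapP[i _ ->]; apply: a0.
rewrite big_map -[k in iota _ k]subn0 -/(index_iota 0 k) big_mkord bigA_distr_bigA /=.
rewrite coef_sum /multicolor_p /multicolor_partitions -sum1_card natr_sum.
rewrite big_mkcond /=; apply: eq_bigr => m _; rewrite inE.
rewrite -(big_morph (fun j => 'X^j : {poly int})%R (fun x y => exprD _ x y) (expr0 _)).
by rewrite coefXn eq_sym; case: eqP.
Qed.

Local Open Scope ring_scope.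

(** * Sequences as linear functionals on polynomials *)

(** The linear functional sending 'X^n to [u n].  Applying a polynomial in the
    forward shift operator to [u] amounts to multiplying the argument by this
    polynomial, so that identities between difference operators become
    polynomial identities. *)
Definition umbra (u : nat -> int) (q : {poly int}) : int :=
  \sum_(i < size q) q`_i * u i.

Lemma umbra_widen u (q : {poly int}) N : (size q <= N)%N ->
  umbra u q = \sum_(i < N) q`_i * u i.
Proof.
move=> le_qN; rewrite /umbra.
rewrite (big_ord_widen N (fun i => q`_i * u i) le_qN) big_mkcond /=.
by apply: eq_bigr => i _; case: ltnP => // le_qi; rewrite nth_default ?mul0r.
Qed.

Lemma umbraD u p q : umbra u (p + q) = umbra u p + umbra u q.
Proof.
set N := maxn (size p) (size q).
rewrite !(@umbra_widen _ _ N) ?leq_maxl ?leq_maxr ?(leq_trans (size_polyD _ _)) //.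
by rewrite -big_split; apply: eq_bigr => i _; rewrite coefD mulrDl.
Qed.

Lemma umbraZ u c q : umbra u (c *: q) = c * umbra u q.
Proof.
rewrite !(@umbra_widen _ _ (size q)) ?size_scale_leq // mulr_sumr.
by apply: eq_bigr => i _; rewrite coefZ mulrA.
Qed.

Lemma umbraB u p q : umbra u (p - q) = umbra u p - umbra u q.
Proof. by rewrite umbraD -scaleN1r umbraZ mulN1r. Qed.

Lemma umbra_sum u I r (F : I -> {poly int}) :
  umbra u (\sum_(i <- r) F i) = \sum_(i <- r) umbra u (F i).
Proof.
elim: r => [|i r IHr]; last by rewrite !big_cons umbraD IHr.
by rewrite !big_nil -(scale0r 1) umbraZ mul0r.
Qed.

Lemma umbraXn u n : umbra u 'X^n = u n.
Proof.
rewrite (@umbra_widen _ _ n.+1) ?size_polyXn // big_ord_recr /= big1 => [|i _].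
  by rewrite coefXn eqxx mul1r add0r.
by rewrite coefXn ltn_eqF ?mul0r.
Qed.

Lemma umbra_mul u p r : umbra u (p * r) = \sum_(i < size r) r`_i * umbra u (p * 'X^i).
Proof.
rewrite -{1}[r]coefK poly_def mulr_sumr umbra_sum.
by apply: eq_bigr => i _; rewrite -scalerAr umbraZ.
Qed.

Lemma umbra_ext u v p q :
    (forall i, umbra u (p * 'X^i) = umbra v (q * 'X^i)) ->
  forall r, umbra u (p * r) = umbra v (q * r).
Proof. by move=> uv r; rewrite !umbra_mul; apply: eq_bigr => i _; rewrite uv. Qed.

Definition geom (a : nat) : {poly int} := \sum_(i < a) 'X^i.

Lemma geomE a : ('X - 1) * geom a = 'X^a - 1.
Proof. by rewrite subrX1. Qed.

Lemma geom1 a : (geom a).[1] = a%:R.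
Proof.
rewrite horner_sum (eq_bigr (fun=> 1)) => [|i _]; first by rewrite sumr_const card_ord.
by rewrite hornerXn expr1n.
Qed.

Lemma umbra_geom u a m : umbra u (geom a * 'X^m) = \sum_(i < a) u (i + m)%N.
Proof.
by rewrite mulr_suml umbra_sum; apply: eq_bigr => i _; rewrite -exprD umbraXn.
Qed.

Local Notation npz l := (fun n => (npart l n)%:Z).

Lemma umbra_npart_cons a l r : (0 < a)%N ->
  umbra (npz (a :: l)) (('X^a - 1) * r) = umbra (npz l) ('X^a * r).
Proof.
move=> a0; move: r; apply: umbra_ext => i.
rewrite mulrBl mul1r umbraB -exprD !umbraXn addnC (npartD _ _ a0) PoszD; lia.
Qed.

Lemma npart1 a n : (0 < a)%N -> npart [:: a] n = (a %| n)%N.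
Proof.
move=> a0; elim/ltn_ind: n => n IHn; case: (ltnP n a) => [lt_na|le_an].
  by rewrite npart_lt //=; case: n lt_na {IHn} => [|n] lt_na; rewrite ?dvdn0 // gtnNdvd.
rewrite -(subnK le_an) npartD // IHn; last by lia.
by rewrite dvdn_addl // /= addn_eq0; case: (a) a0 => //= b _; rewrite andbF addn0.
Qed.

Lemma sum_dvdn a m : (0 < a)%N -> (\sum_(i < a) (a %| i + m) = 1)%N.
Proof.
move=> a0; elim: m => [|m IHm].
  case: a a0 => // a _; rewrite big_ord_recl addn0 dvdn0 big1 // => i _.
  by rewrite addn0 gtnNdvd // lift0 ltnS.
rewrite -{}IHm -!(big_mkord xpredT (fun i => (a %| i + _)%N : nat)).
apply: (@addnI (a %| m)%N).
rewrite [RHS]addnC -{2}(dvdn_addr m (dvdnn a)) -big_nat_recr //= big_nat_recl //.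
by congr (_ + _)%N; apply: eq_bigr => i _; rewrite addSnnS.
Qed.

(** The denominator of the generating function is (1 - x)^k times the product
    of the [geom a].  Removing one factor 1 - x from it leaves a sequence killed
    by the remaining difference operator, that is a constant; its value is found
    from the case of a single part [a], where any [a] consecutive integers
    contain exactly one multiple of [a]. *)
Lemma umbra_npart l r : l != [::] -> all (leq 1) l ->
  umbra (npz l) (('X - 1) ^+ (size l).-1 * \prod_(a <- l) geom a * r) = r.[1].
Proof.
elim: l r => [|a [|b l] IHl] // r _ /andP[a0 l0].
  rewrite expr0 mul1r big_seq1 umbra_mul horner_coef; apply: eq_bigr => i _.
  congr (_ * _); rewrite umbra_geom expr1n.
  rewrite -[1]/(Posz 1) -(sum_dvdn i a0) (big_morph Posz PoszD (erefl _)).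
  by apply: eq_bigr => j _; rewrite npart1.
rewrite big_cons; set V := \prod_(_ <- _) _; rewrite [(size _).-1]/= exprS.
have -> : ('X - 1) * ('X - 1) ^+ size l * (geom a * V) * r =
   ('X^a - 1) * (('X - 1) ^+ size l * V * r) by rewrite -geomE; ring.
rewrite umbra_npart_cons //.
have -> : 'X^a * (('X - 1) ^+ size l * V * r) = ('X - 1) ^+ (size l) * V * ('X^a * r).
  by ring.
by rewrite IHl // hornerM hornerXn expr1n mul1r.
Qed.

(** * Cyclotomic factors of the denominator *)

Lemma geom_Cyclotomic L a : (0 < L)%N -> (a %| L)%N ->
  geom a = \prod_(d <- divisors L | (1 < d)%N && (d %| a)%N) 'Phi_d.
Proof.
move=> L0 aL; have a0 : (0 < a)%N by apply: dvdn_gt0 aL.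
have Phi1 : 'Phi_1 = 'X - 1.
  by rewrite -['X]expr1 -prod_Cyclotomic // (_ : divisors 1 = [:: 1%N]) // big_seq1.
apply: (@mulfI _ ('X - 1)); first by rewrite polyXsubC_eq0.
rewrite geomE -prod_Cyclotomic // (bigD1_seq 1%N) ?divisors_uniq -?dvdn_divisors //=.
rewrite Phi1; congr (_ * _).
rewrite (perm_big [seq d <- divisors L | (d %| a)%N]) /=; last first.
  apply: uniq_perm; rewrite ?filter_uniq ?divisors_uniq // => d.
  rewrite mem_filter -!dvdn_divisors //.
  by case da: (d %| a)%N; rewrite ?andbF //= (dvdn_trans da aL).
rewrite big_filter_cond big_seq_cond [RHS]big_seq_cond.
apply: eq_bigl => d; rewrite -dvdn_divisors //.
case dL: (d %| L)%N => //=; have := dvdn_gt0 L0 dL.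
by case: d {dL} => [|[|d]] //; rewrite andbC.
Qed.

(** The exponent of 'Phi_d, d > 1, is the number of multiples of [d] in [l] on
    the one side, and [m] on the other. *)
Lemma prod_geom_dvd L m l : (0 < L)%N -> all (dvdn^~ L) l ->
    (forall d, (1 < d)%N -> (count (dvdn d) l <= m)%N) ->
  exists W, geom L ^+ m = (\prod_(a <- l) geom a) * W.
Proof.
move=> L0 lL cnt.
exists (\prod_(d <- divisors L | (1 < d)%N) 'Phi_d ^+ (m - count (dvdn d) l)).
have -> : \prod_(a <- l) geom a =
    \prod_(d <- divisors L | (1 < d)%N) 'Phi_d ^+ count (dvdn d) l.
  rewrite (eq_big_seq (fun a => \prod_(d <- divisors L | (1 < d)%N)
    (if (d %| a)%N then 'Phi_d else 1))) => [|a al].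
    rewrite exchange_big /=; apply: eq_bigr => d _.
    by rewrite -big_mkcond big_const_seq iter_mulr_1.
  by rewrite (geom_Cyclotomic L0) ?(allP lL) // big_mkcondr.
rewrite (geom_Cyclotomic L0 (dvdnn _)) -big_split -prodrXl /=.
rewrite big_seq_cond [RHS]big_seq_cond; apply: eq_big => [d|d].
  by rewrite -dvdn_divisors //; case: (d %| L)%N; rewrite ?andbF ?andbT.
by case/and3P=> _ d1 _; rewrite -exprD subnKC ?cnt.
Qed.

(** The pole at 1 has order m+1 after [j] differences, and the other poles have
    order at most [m]; so [m] further differences with a step [L] that is a
    common multiple of the parts reduce everything to a constant. *)
Lemma umbra_npart_top l j m L : all (leq 1) l -> (0 < L)%N -> all (dvdn^~ L) l ->
    size l = (j + m).+1 -> (forall d, (1 < d)%N -> (count (dvdn d) l <= m)%N) ->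
  forall n, (umbra (npz l) (('X - 1) ^+ j * ('X^L - 1) ^+ m * 'X^n))%:~R
    = (L ^ m)%:R / (\prod_(a <- l) a)%:R :> rat.
Proof.
move=> l0 L0 lL sz cnt n; have [W SW] := prod_geom_dvd L0 lL cnt.
have -> : ('X - 1) ^+ j * ('X^L - 1) ^+ m * 'X^n =
    ('X - 1) ^+ (size l).-1 * \prod_(a <- l) geom a * (W * 'X^n).
  by rewrite -geomE exprMn SW sz /= exprD; ring.
have ln0 : l != [::] by case: (l) sz.
rewrite umbra_npart // hornerM hornerXn expr1n mulr1.
have P0 : (\prod_(a <- l) a)%:R != 0 :> rat.
  by rewrite pnatr_eq0 -lt0n big_seq prodn_cond_gt0 // => a /(allP l0).
apply: (canRL (mulfK P0)).
have -> : (\prod_(a <- l) a)%:R = (\prod_(a <- l) geom a).[1]%:~R :> rat.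
  by rewrite horner_prod (eq_bigr _ (fun a _ => geom1 a)) -natr_prod rmorph_nat.
by rewrite -intrM mulrC -hornerM -SW horner_exp geom1 -natrX rmorph_nat.
Qed.

(** * Asymptotics of the differences *)

(** For [c != 0] this is the usual asymptotic equivalence; for [c = 0] it reads
    w n = o(n^r). *)
Definition asymp (w : nat -> rat) (c : rat) (r : nat) :=
  forall e, 0 < e -> exists N, forall n, (N <= n)%N ->
    `|w n - c * n%:R ^+ r| <= e * n%:R ^+ r.

Lemma eventually_ge (x : rat) : exists N, forall n, (N <= n)%N -> x <= n%:R.
Proof.
exists (Num.bound `|x|) => n le_xn; apply: le_trans (_ : (Num.bound `|x|)%:R <= _).
  by apply: le_trans (ler_norm _) _; apply: ltW (archi_boundP _).
by rewrite ler_nat.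
Qed.

Lemma expr_shift_asymp (L r : nat) (e : rat) : 0 < e ->
  exists N, forall n, (N <= n)%N -> (n + L)%:R ^+ r <= (1 + e) * n%:R ^+ r.
Proof.
elim: r e => [|r IHr] e e0.
  by exists 0%N => n _; rewrite !expr0 mulr1 lerDl ltW.
pose d := Num.min e 1 / 3%:R.
have d0 : 0 < d by rewrite divr_gt0 // lt_min e0 ltr01.
have d1 : d <= 1.
  by have: Num.min e 1 <= 1 by [rewrite ge_min lexx orbT]; rewrite /d; lra.
have de : d * 3%:R <= e by rewrite /d mulfVK // ge_min lexx.
have [N1 H1] := IHr d d0; have [N2 H2] := eventually_ge (L%:R / d).
exists (maxn N1 N2) => n; rewrite geq_max => /andP[le1 le2].
have A1 := H1 n le1.
have A2 : (n + L)%:R <= (1 + d) * n%:R.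
  by rewrite natrD mulrDl mul1r lerD2l mulrC -ler_pdivrMr // H2.
rewrite !exprS; apply: le_trans (ler_pM _ _ A2 A1) _; rewrite ?exprn_ge0 ?ler0n //.
rewrite mulrACA ler_wpM2r ?mulr_ge0 ?exprn_ge0 ?ler0n //.
nra.
Qed.

Lemma expr_diff_asymp (L r : nat) :
  asymp (fun n => (n + L)%:R ^+ r.+1 - n%:R ^+ r.+1) (L * r.+1)%:R r.
Proof.
move=> e e0; pose d := e / (L * r.+1).+1%:R.
have d0 : 0 < d by rewrite divr_gt0 // ltr0Sn.
have [N H] := @expr_shift_asymp L r d d0; exists N => n /H{H} H.
have Sle : n%:R ^+ r *+ r.+1 <=
    \sum_(i < r.+1) ((n + L)%:R : rat) ^+ (r - i) * n%:R ^+ i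
      <= ((1 + d) * n%:R ^+ r) *+ r.+1.
  have bnd (i : 'I_r.+1) :
      n%:R ^+ r <= ((n + L)%:R : rat) ^+ (r - i) * n%:R ^+ i <= (n + L)%:R ^+ r.
    have le_ir : (i <= r)%N by rewrite -ltnS.
    have xy : n%:R <= (n + L)%:R :> rat by rewrite ler_nat leq_addr.
    have E (z : rat) : z ^+ r = z ^+ (r - i) * z ^+ i by rewrite -exprD subnK.
    rewrite [n%:R ^+ r]E [(n + L)%:R ^+ r]E; apply/andP; split.
      by rewrite ler_wpM2r ?exprn_ge0 // lerXn2r ?nnegrE.
    by rewrite ler_wpM2l ?exprn_ge0 // lerXn2r ?nnegrE.
  have E (z : rat) : z *+ r.+1 = \sum_(i < r.+1) z by rewrite sumr_const card_ord.
  apply/andP; split; rewrite E ler_sum // => i _.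
    by case/andP: (bnd i).
  by case/andP: (bnd i) => _ /le_trans; apply.
rewrite subrXX natrD addrAC subrr add0r.
set S := \sum_(_ < _) _.
have {}Sle : n%:R ^+ r *+ r.+1 <= S <= ((1 + d) * n%:R ^+ r) *+ r.+1.
  by rewrite /S -natrD.
move: Sle; set x := n%:R ^+ r => /andP[S1 S2].
have x0 : 0 <= x by rewrite exprn_ge0.
rewrite natrM -mulrA -mulrBr normrM normr_nat ger0_norm; last first.
  by rewrite subr_ge0 mulr_natl.
apply: le_trans (_ : L%:R * (d * x *+ r.+1) <= _).
  by rewrite ler_wpM2l // lerBlDr mulr_natl -mulrnDl addrC -{1}[x]mul1r -mulrDl.
have -> : L%:R * (d * x *+ r.+1) = (L * r.+1)%:R * d * x.
  by rewrite -mulr_natr natrM; ring.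
rewrite ler_wpM2r // /d mulrCA ger_pMr // ler_pdivrMr ?ltr0Sn //.
by rewrite mul1r ler_nat.
Qed.

(** Stolz-Cesaro theorem for differences with step [L].  Subtracting the
    expected main term leaves differences of size o(n^r), which add up to
    o(n^(r+1)). *)
Lemma asymp_sum w c r L : (0 < L)%N -> asymp (fun n => w (n + L)%N - w n) c r ->
  asymp w (c / (L * r.+1)%:R) r.+1.
Proof.
move=> L0 wc e e0; set c' := c / _.
have Lr0 : (L * r.+1)%:R != 0 :> rat by rewrite pnatr_eq0 -lt0n muln_gt0 L0.
have e4 : 0 < e / 4%:R by rewrite divr_gt0.
pose d := e / 4%:R / (`|c'| + 1).
have c'0 : 0 < `|c'| + 1 by rewrite ltr_wpDl.
have d0 : 0 < d by rewrite divr_gt0.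
have [N1 H1] := wc _ e4; have [N2 H2] := expr_diff_asymp L r d0.
pose N := maxn N1 N2; pose y n := w n - c' * n%:R ^+ r.+1.
have dy n : (N <= n)%N -> `|y (n + L)%N - y n| <= e / 2%:R * n%:R ^+ r.
  rewrite geq_max => /andP[/H1{}H1 /H2{}H2].
  have -> : y (n + L)%N - y n = (w (n + L)%N - w n - c * n%:R ^+ r) -
     c' * ((n + L)%:R ^+ r.+1 - n%:R ^+ r.+1 - (L * r.+1)%:R * n%:R ^+ r).
    by rewrite -[c](mulfVK Lr0) -/c' /y; ring.
  apply: le_trans (ler_normB _ _) _; rewrite normrM.
  have : `|c'| * `|(n + L)%:R ^+ r.+1 - n%:R ^+ r.+1 - (L * r.+1)%:R * n%:R ^+ r|
      <= e / 4%:R * n%:R ^+ r.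
    apply: le_trans (ler_wpM2l (normr_ge0 _) H2) _.
    rewrite mulrA ler_wpM2r ?exprn_ge0 // /d mulrCA ger_pMr // ler_pdivrMr //.
    by rewrite mul1r lerDl.
  by move: H1; set X := n%:R ^+ r; lra.
(* B dominates y on the window [N, N + L), from which steps of L start. *)
pose B := \sum_(i < N + L) `|y i|.
have yB n : (N <= n)%N -> `|y n| <= B + e / 2%:R * n%:R ^+ r.+1.
  elim/ltn_ind: n => n IHn le_Nn; case: (ltnP n (N + L)) => [lt_n|le_n].
    apply: (@le_trans _ _ B); last first.
      by rewrite lerDl mulr_ge0 ?exprn_ge0 // divr_ge0 // ltW.
    by rewrite /B (bigD1 (Ordinal lt_n)) //= lerDl sumr_ge0.
  have [m m_n] : exists m, n = (m + L)%N by exists (n - L)%N; rewrite subnK //; lia.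
  have {}IHn := IHn m; rewrite {n}m_n in le_Nn le_n IHn *.
  have le_Nm : (N <= m)%N by lia.
  have lt_m : (m < m + L)%N by lia.
  have := dy m le_Nm; have := IHn lt_m le_Nm.
  have := ler_normD (y (m + L)%N - y m) (y m).
  rewrite subrK.
  have : e / 2%:R * (m%:R ^+ r.+1 + m%:R ^+ r) <= e / 2%:R * (m + L)%:R ^+ r.+1.
    rewrite ler_wpM2l //; first by rewrite divr_ge0 // ltW.
    rewrite -[X in _ + X]mul1r exprS -mulrDl exprS.
    rewrite natr1 ler_pM ?exprn_ge0 //; last first.
      by rewrite lerXn2r ?nnegrE ?ler_nat ?leq_addr.
    by rewrite ler_nat -addn1 leq_add2l.
  by rewrite mulrDr; set X := m%:R ^+ r; set Y := m%:R ^+ r.+1; lra.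
have [N3 H3] := eventually_ge (B / (e / 2%:R)).
exists (maxn N (maxn N3 1)) => n; rewrite geq_max => /andP[le1].
rewrite geq_max => /andP[le3 n0].
rewrite -/(y n); apply: le_trans (yB n le1) _.
have : B <= e / 2%:R * n%:R ^+ r.+1.
  have := H3 n le3; rewrite ler_pdivrMr ?divr_gt0 // mulrC => /le_trans; apply.
  rewrite ler_wpM2l //; first by rewrite divr_ge0 // ltW.
  by rewrite ler_eXnr // ler1n.
by set X := n%:R ^+ r.+1; lra.
Qed.

Lemma asymp_iter (Z : nat -> nat -> rat) (L m : nat) (c : rat) : (0 < L)%N ->
    (forall i n, Z i (n + L)%N - Z i n = Z i.+1 n) -> (forall n, Z m n = c) ->
  asymp (Z 0%N) (c / (L ^ m * m`!)%:R) m.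
Proof.
move=> L0; elim: m Z => [|m IHm] Z dZ Zm.
  by move=> e e0; exists 0%N => n _; rewrite Zm divr1 !mulr1 subrr normr0 ltW.
have /(asymp_sum L0) :
    asymp (fun n => Z 0%N (n + L)%N - Z 0%N n) (c / (L ^ m * m`!)%:R) m.
  have := IHm (fun i => Z i.+1) (fun i => dZ i.+1) Zm.
  by move=> H e /H[N {}H]; exists N => n /H; rewrite dZ.
by congr asymp; rewrite -mulrA -invfM -natrM factS expnS; congr (_ / _%:R); ring.
Qed.

(** The [j]-th forward difference of [npart l]. *)
Definition npart_diff l j n : int := umbra (npz l) (('X - 1) ^+ j * 'X^n).

Lemma npart_diff0 l n : npart_diff l 0 n = (npart l n)%:Z.
Proof. by rewrite /npart_diff mul1r umbraXn. Qed.

Lemma npart_diffS l j n : npart_diff l j.+1 n = npart_diff l j n.+1 - npart_diff l j n.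
Proof. by rewrite /npart_diff -umbraB; congr umbra; rewrite exprSr exprS; ring. Qed.

(** The bound on [count] says that no pole outside 1 reaches the order m+1 that
    the pole at 1 retains after [j] differences. *)
Theorem npart_diff_asymp l j m : all (leq 1) l -> size l = (j + m).+1 ->
    (forall d, (1 < d)%N -> (count (dvdn d) l <= m)%N) ->
  asymp (fun n => (npart_diff l j n)%:~R) ((\prod_(a <- l) a) * m`!)%N%:R^-1 m.
Proof.
move=> l0 sz cnt; pose L := (\prod_(a <- l) a)%N.
have L0 : (0 < L)%N by rewrite /L big_seq prodn_cond_gt0 // => a /(allP l0).
have lL : all (dvdn^~ L) l.
  by apply/allP => a al; rewrite /L (big_rem a al) dvdn_mulr.
pose Z i n : rat := (umbra (npz l) (('X - 1) ^+ j * ('X^L - 1) ^+ i * 'X^n))%:~R.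
have := @asymp_iter Z L m _ L0 _ (umbra_npart_top l0 L0 lL sz cnt).
have -> : (L ^ m)%:R / (\prod_(a <- l) a)%:R / (L ^ m * m`!)%:R =
    (\prod_(a <- l) a * m`!)%:R^-1 :> rat.
  rewrite -/L !natrM; field.
  by rewrite !pnatr_eq0 -!lt0n fact_gt0 expn_gt0 L0.
rewrite /Z expr0 mulr1; apply=> i n.
rewrite -rmorphB -umbraB; congr (umbra _ _)%:~R.
by rewrite exprD exprSr; ring.
Qed.

(** * Sufficiency *)


Lemma asymp_ratio w c r e : asymp w c r -> 0 < e ->
  exists N, forall n, (N <= n)%N -> `|w n / n%:R ^+ r - c| <= e.
Proof.
move=> wc /wc[N wN]; exists N.+1 => n le_Nn.
have n0 : 0 < n%:R ^+ r :> rat by rewrite exprn_gt0 // ltr0n; lia.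
rewrite -[c](mulfK (lt0r_neq0 n0)) -mulrBl normrM [`|_^-1|]gtr0_norm ?invr_gt0 //.
by rewrite ler_pdivrMr // wN // ltnW.
Qed.

(** Continuity of a^2 - b c at (x, y, z), used to pass from the limits of the
    normalized differences to a strict inequality between their values. *)
Lemma discriminant_continuous (x y z e : rat) : 0 < e ->
  exists2 d, 0 < d & forall a b c, `|a - x| <= d -> `|b - y| <= d -> `|c - z| <= d ->
    `|(a ^+ 2 - b * c) - (x ^+ 2 - y * z)| < e.
Proof.
move=> e0; pose K := 2%:R * `|x| + `|y| + `|z| + 2%:R.
have K0 : 0 < K by rewrite ltr_wpDl ?addr_ge0 ?mulr_ge0.
pose d := Num.min 1 (e / (2%:R * K)).
have K20 : 0 < 2%:R * K by rewrite mulr_gt0.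
have d0 : 0 < d by rewrite lt_min ltr01 divr_gt0.
have d1 : d <= 1 by rewrite ge_min lexx.
have dK : d * K < e.
  have : d * (2%:R * K) <= e by rewrite -ler_pdivlMr // ge_min lexx orbT.
  have : 0 < d * K by rewrite mulr_gt0.
  lra.
exists d => // a b c ax yb cz; apply: le_lt_trans dK.
have -> : (a ^+ 2 - b * c) - (x ^+ 2 - y * z) =
  (a - x) * (2%:R * x + (a - x)) - ((b - y) * (z + (c - z)) + y * (c - z)) by ring.
apply: le_trans (ler_normB _ _) _.
have -> : d * K = d * (2%:R * `|x| + 1) + (d * (`|z| + 1) + `|y| * d).
  by rewrite /K; ring.
apply: lerD.
  rewrite normrM ler_pM // (le_trans (ler_normD _ _)) // normrM normr_nat.
  by rewrite lerD2l (le_trans ax).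
apply: le_trans (ler_normD _ _) _; rewrite !normrM; apply: lerD.
  by rewrite ler_pM // (le_trans (ler_normD _ _)) // lerD2l (le_trans cz).
by rewrite ler_wpM2l.
Qed.

Lemma npart_diff1 l n : npart_diff l 1 n = (npart l n.+1)%:Z - (npart l n)%:Z.
Proof. by rewrite npart_diffS !npart_diff0. Qed.

Lemma npart_diff2 l n :
  npart_diff l 2 n = (npart l n.+2)%:Z - (npart l n.+1)%:Z *+ 2 + (npart l n)%:Z.
Proof. by rewrite npart_diffS !npart_diff1; ring. Qed.

(** Expanding u_1^2 - u_0 u_2 in the values of u, the cross terms cancel. *)
Lemma log_concave_diff l n : (npart l n.+2 * npart l n < npart l n.+1 ^ 2)%N =
  ((npart_diff l 0 n)%:~R * (npart_diff l 2 n)%:~R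
    < (npart_diff l 1 n)%:~R ^+ 2 :> rat).
Proof.
rewrite -rmorphXn -rmorphM /= ltr_int -ltz_nat -[LHS]subr_gt0 -[RHS]subr_gt0.
rewrite npart_diff0 npart_diff1 npart_diff2; congr (0 < _).
by rewrite PoszM -[X in X - _]natz natrX !natz; ring.
Qed.

(** With c_i = 1 / (P (m+2-i)!) the limit of the i-th difference over n^(m+2-i),
    c_1^2 - c_0 c_2 > 0 because m! (m+2)! > (m+1)!^2. *)
Lemma npart_log_concave l m : all (leq 1) l -> size l = m.+3 ->
    (forall d, (1 < d)%N -> (count (dvdn d) l <= m)%N) ->
  eventually_log_concave (npart l).
Proof.
move=> l0 sz cnt.
have A2 := @npart_diff_asymp l 2 m l0 sz cnt.
have A1 := @npart_diff_asymp l 1 m.+1 l0 sz (fun d d1 => leqW (cnt d d1)).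
have A0 := @npart_diff_asymp l 0 m.+2 l0 sz (fun d d1 => leqW (leqW (cnt d d1))).
set c2 := _^-1 in A2; set c1 := _^-1 in A1; set c0 := _^-1 in A0.
have P0 : (0 < \prod_(a <- l) a)%N by rewrite big_seq prodn_cond_gt0 // => a /(allP l0).
have P0' : (\prod_(a <- l) a)%:R != 0 :> rat by rewrite pnatr_eq0 -lt0n.
have F0 : (m`!)%:R != 0 :> rat by rewrite pnatr_eq0 -lt0n fact_gt0.
have gap : 0 < c1 ^+ 2 - c0 * c2.
  have -> : c1 ^+ 2 - c0 * c2 =
      ((\prod_(a <- l) a)%:R ^+ 2 * m`!%:R ^+ 2 * m.+1%:R ^+ 2 * m.+2%:R)^-1.
    rewrite /c0 /c1 /c2 !factS !natrM; field.
    by rewrite P0' F0 nat1r -natrD !pnatr_eq0.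
  by rewrite invr_gt0; do !apply: mulr_gt0; rewrite ?exprn_gt0 ?ltr0n ?fact_gt0.
have [e e0 close] := discriminant_continuous c1 c0 c2 gap.
have [N0 H0] := asymp_ratio A0 e0; have [N1 H1] := asymp_ratio A1 e0.
have [N2 H2] := asymp_ratio A2 e0.
exists (N0 + N1 + N2).+1 => -[//|n]; rewrite ltnS log_concave_diff => le_n.
have [leN0 leN1 leN2 n_gt0] : [/\ N0 <= n, N1 <= n, N2 <= n & 0 < n]%N.
  by split; move: le_n; clear; lia.
have n0 : 0 < n%:R :> rat by rewrite ltr0n.
have {H0 H1 H2 close} := close _ _ _ (H1 n leN1) (H0 n leN0) (H2 n leN2).
rewrite ltr_distl => /andP[+ _].
rewrite subrr expr_div_n mulf_div => lt0.
rewrite -subr_gt0; move: lt0.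
set a := _%:~R; set b := _%:~R; set c := _%:~R.
rewrite -exprM -exprD (_ : m.+2 + m = m.+1 * 2)%N; last by lia.
by rewrite -mulrBl pmulr_lgt0 // invr_gt0 exprn_gt0.
Qed.

(** * Necessity *)

Lemma log_concave_perm l1 l2 : all (leq 1) l1 -> perm_eq l1 l2 ->
  eventually_log_concave (npart l1) -> eventually_log_concave (npart l2).
Proof.
move=> l0 l12 [N H]; exists N => n /H.
by rewrite !(fun n => npart_perm n l0 l12).
Qed.

(** Consecutive ratios decrease strictly, so after one ratio at most 1 all later
    ones are below 1, and natural numbers cannot decrease forever. *)
Lemma log_concave_increasing (u : nat -> nat) : eventually_log_concave u ->
  exists N, forall n, (N <= n)%N -> (u n < u n.+1)%N.
Proof.
case=> N lc; exists N.+1 => n le_Nn; rewrite ltnNge; apply/negP => le_u.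
suff dec j : (u (n + j.+1) + j <= u n.+1 /\ u (n + j.+1) <= u (n + j))%N.
  by have [] := dec (u n.+1).+1; lia.
elim: j => [|j [IH1 IH2]]; first by rewrite !addn0 addn1; split.
have := lc (n + j.+1)%N; rewrite (_ : N < n + j.+1)%N; last by lia.
rewrite [in X in (_ * u X)%N]addnS /= -addnS => /(_ isT) lt_u.
have : (u (n + j.+2) < u (n + j.+1))%N by nia.
lia.
Qed.

Lemma npart_ndvd d l n : all (dvdn d) l -> ~~ (d %| n)%N -> npart l n = 0%N.
Proof.
elim: l n => [|a l IHl] n /=; first by move=> _; case: n => //; rewrite dvdn0.
case/andP=> da dl dn; rewrite big1 // => j le_jan; apply: IHl => //.
by rewrite dvdn_subl ?dvdn_mull.
Qed.

(** Dividing all parts and their sum by [D] is a bijection of partitions. *)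
Lemma npart_scale D l n : (0 < D)%N -> all (leq 1) l ->
  npart [seq (D * a)%N | a <- l] (D * n)%N = npart l n.
Proof.
move=> D0; elim: l n => [|a l IHl] n /=.
  by move=> _; case: n => [|n]; rewrite ?muln0 // muln_eq0; case: (D) D0.
case/andP=> a0 l0.
have := @npart_cons_nat (D * n) (D * a) [seq (D * b)%N | b <- l] (D * n).
rewrite muln_gt0 D0 a0 leqnn => /(_ isT isT) /= ->.
have := @npart_cons_nat (D * n) a l n a0; rewrite leq_pmull // => /(_ isT) /= ->.
apply: eq_big => [j|j _]; first by rewrite mulnCA leq_pmul2l.
by rewrite mulnCA -mulnBr IHl.
Qed.

(** If [d] divided all parts except perhaps [x], the partitions of [n + x] that
    omit [x] would be absent whenever [d] does not divide [n + x], and so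
    [npart] would take the same value at [n] and [n + x]. *)
Lemma log_concave_two_ndvd l d : all (leq 1) l -> l != [::] -> (1 < d)%N ->
  eventually_log_concave (npart l) -> (1 < count (predC (dvdn d)) l)%N.
Proof.
move=> l0 ln0 d1 lc; rewrite ltnNge; apply/negP => cnt.
have [x [l' [ll' dl']]] : exists x l', perm_eq l (x :: l') /\ all (dvdn d) l'.
  have /permPl := perm_filterC (dvdn d) l; rewrite perm_sym.
  move: cnt; rewrite -size_filter; case: (filter _ l) => [|x [|//]] _.
    rewrite cats0 => lf; case: (l) ln0 lf => // x s _ lf; exists x, s; split => //.
    by have := filter_all (dvdn d) (x :: s); rewrite -(perm_all _ lf) => /andP[].
  move=> lf; exists x, (filter (dvdn d) l); split; last exact: filter_all.
  by apply: perm_trans lf _; rewrite cats1 perm_rcons.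
have {}lc := log_concave_perm l0 ll' lc.
have [N inc] := log_concave_increasing lc.
have x0 : (0 < x)%N by move: l0; rewrite (perm_all _ ll') => /andP[].
have mono j n : (N <= n)%N -> (npart (x :: l') n + j <= npart (x :: l') (n + j))%N.
  move=> le_Nn; elim: j => [|j IHj]; first by rewrite !addn0.
  have := inc (n + j)%N; rewrite (leq_trans le_Nn) ?leq_addr // => /(_ isT).
  by rewrite !addnS; lia.
(* n + x is 1 modulo d and n is at least N. *)
pose n := (d * (N + x) + 1 - x)%N.
have le_Nn : (N <= n)%N by rewrite /n; nia.
have v0 : npart l' (n + x) = 0%N.
  apply: npart_ndvd dl' _; rewrite /n subnK; last by nia.
  by rewrite dvdn_addr ?dvdn_mulr // dvdn1; lia.
by have := mono x n le_Nn; rewrite npartD // v0 leq_add2l leqNgt x0.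
Qed.

(** Log-concavity bounds the second difference by u_1^2 / u_0, whose growth is
    known even when poles of order m+1 outside 1 make that of u_2 itself
    irregular. *)
Lemma npart_diff2_bound l m (c : rat) : all (leq 1) l -> size l = m.+3 ->
    (forall d, (1 < d)%N -> (count (dvdn d) l <= m.+1)%N) ->
    eventually_log_concave (npart l) ->
    m.+2%:R / (\prod_(a <- l) a * m.+1`!)%N%:R < c ->
  exists N, forall n, (N <= n)%N -> (npart_diff l 2 n)%:~R <= c * n%:R ^+ m.
Proof.
move=> l0 sz cnt [N lc] lt_c.
have A1 := @npart_diff_asymp l 1 m.+1 l0 sz cnt.
have A0 := @npart_diff_asymp l 0 m.+2 l0 sz (fun d d1 => leqW (cnt d d1)).
set c1 := _^-1 in A1; set c0 := _^-1 in A0.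
have P0 : (0 < \prod_(a <- l) a)%N by rewrite big_seq prodn_cond_gt0 // => a /(allP l0).
have P0' : (\prod_(a <- l) a)%:R != 0 :> rat by rewrite pnatr_eq0 -lt0n.
have F0 : (m`!)%:R != 0 :> rat by rewrite pnatr_eq0 -lt0n fact_gt0.
have gap : 0 < c0 * c - c1 ^+ 2.
  have c00 : 0 < c0 by rewrite invr_gt0 ltr0n muln_gt0 P0 fact_gt0.
  rewrite subr_gt0.
  apply: le_lt_trans (_ : c0 * (m.+2%:R / (\prod_(a <- l) a * m.+1`!)%N%:R) < _).
    rewrite le_eqVlt; apply/orP; left; apply/eqP.
    rewrite /c0 /c1 !factS !natrM; field.
    by rewrite P0' F0 nat1r -natrD !pnatr_eq0.
  by rewrite ltr_pM2l.
have [e e0 close] := discriminant_continuous c1 c0 c gap.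
have [N0 H0] := asymp_ratio A0 e0; have [N1 H1] := asymp_ratio A1 e0.
exists (N + N0 + N1).+1 => n le_n; rewrite leNgt; apply/negP => lt2.
have [leN leN0 leN1 n_gt0] : [/\ N < n.+1, N0 <= n, N1 <= n & 0 < n]%N.
  by split; move: le_n; clear; lia.
have n0 : 0 < n%:R :> rat by rewrite ltr0n.
have := lc n.+1 leN; rewrite /= log_concave_diff.
have {H0 H1 close} := close _ _ c (H1 n leN1) (H0 n leN0).
rewrite subrr normr0 => /(_ (ltW e0)).
rewrite ltr_distl => /andP[_]; rewrite addrA subrK subrr subr_lt0 expr_div_n.
rewrite npart_diff0; move: lt2.
set a := (npart_diff l 1 n)%:~R; set b := (Posz (npart l n))%:~R.
set d := (npart_diff l 2 n)%:~R.
have X0 : 0 < n%:R ^+ m :> rat by rewrite exprn_gt0.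
have Y0 : 0 < n%:R ^+ m.+2 :> rat by rewrite exprn_gt0.
rewrite -exprM (_ : m.+1 * 2 = m + m.+2)%N; last by clear; lia.
rewrite exprD; move: X0 Y0; set X := n%:R ^+ m; set Y := n%:R ^+ m.+2 => X0 Y0 lt2.
rewrite (ltr_pdivrMr _ _ (mulr_gt0 X0 Y0)).
have -> : b / Y * c * (X * Y) = b * (c * X) by field; rewrite lt0r_neq0.
by move=> lt1 /lt_trans/(_ lt1); rewrite ltNge ler_wpM2l ?ler0z //; exact: ltW.
Qed.

(** The polynomial identity behind this is
    (X^x - 1)(X^y - 1) = (X - 1)^2 geom x geom y. *)
Lemma npart_sum_diff2 x y l n : (0 < x)%N -> (0 < y)%N ->
  (npart l (n + x + y))%:Z =
    \sum_(i < x) \sum_(j < y) npart_diff [:: x, y & l] 2 (n + i + j).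
Proof.
move=> x0 y0.
have <- : umbra (npz [:: x, y & l]) (('X^x - 1) * (('X^y - 1) * 'X^n)) =
    (npart l (n + x + y))%:Z.
  rewrite umbra_npart_cons // mulrCA umbra_npart_cons // -!exprD umbraXn.
  by congr (Posz (npart l _)); lia.
have -> : ('X^x - 1) * (('X^y - 1) * 'X^n) =
    \sum_(i < x) \sum_(j < y) ('X - 1) ^+ 2 * 'X^(n + i + j) :> {poly int}.
  transitivity (('X - 1) ^+ 2 * (geom x * geom y * 'X^n)).
    by rewrite -!geomE; ring.
  rewrite /geom big_distrlr /= mulr_suml mulr_sumr; apply: eq_bigr => i _.
  rewrite mulr_suml mulr_sumr; apply: eq_bigr => j _.
  by rewrite -!exprD; congr (_ * 'X^_); lia.
rewrite umbra_sum; apply: eq_bigr => i _; rewrite umbra_sum.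
by apply: eq_bigr => j _.
Qed.

Lemma sum_const_scaled x y D n m (c : rat) :
  \sum_(i < x) \sum_(j < y) c * (D * n)%:R ^+ m = (x * y * D ^ m)%:R * c * n%:R ^+ m.
Proof.
rewrite !sumr_const !card_ord -mulrnA -[LHS]mulr_natr !natrM natrX exprMn; ring.
Qed.

(** Evaluate [npart_sum_diff2] at the multiples D n, where D is the gcd of the
    parts divisible by [d].  Its left-hand side is then the number of partitions
    of n with the parts divided by D, which are globally coprime, so it grows
    like n^m / (m! Q) with Q their product; its right-hand side is at most
    x y (D n)^m times any constant above (m+2) / (P (m+1)!), where
    P = x y D^(m+1) Q.  Comparing gives D (m+1) <= m+2. *)
Lemma log_concave_gcd l m d : all (leq 1) l -> size l = m.+3 ->
    (forall e, (1 < e)%N -> (count (dvdn e) l <= m.+1)%N) ->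
    eventually_log_concave (npart l) ->
    (1 < d)%N -> count (dvdn d) l = m.+1 ->
  (d * m.+1 <= m.+2)%N.
Proof.
move=> l0 sz cnt lc d1 dl.
have := perm_filterC (dvdn d) l; set f := filter (dvdn d) l => /permPl lf.
have [x [y [xy0 {}lf]]] : exists x y, all (leq 1) [:: x; y] /\ perm_eq l [:: x, y & f].
  move: lf; rewrite perm_catC perm_sym.
  have : size (filter (predC (dvdn d)) l) = 2.
    by have := count_predC (dvdn d) l; rewrite size_filter dl sz; lia.
  case: (filter (predC _) l) => [|x [|y []]] //= _ lf; exists x, y; split=> //.
  by move: l0; rewrite (perm_all _ lf) => /and3P[-> ->].
have f0 : all (leq 1) f by move: l0; rewrite (perm_all _ lf) => /and3P[].
have {lc}lc := log_concave_perm l0 lf lc.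
have {}cnt e : (1 < e)%N -> (count (dvdn e) [:: x, y & f] <= m.+1)%N.
  by rewrite -(permP lf); apply: cnt.
have {}sz : size [:: x, y & f] = m.+3 by rewrite -(perm_size lf).
have {}l0 : all (leq 1) [:: x, y & f] by rewrite -(perm_all _ lf).
have sf : size f = m.+1 by rewrite size_filter.
have fd : all (dvdn d) f by apply: filter_all.
move: (f) sf fd f0 l0 sz cnt lc => {lf dl f}f sf fd f0 l0 sz cnt lc.
pose D := \big[gcdn/0%N]_(a <- f) a.
have dD : (d %| D)%N.
  rewrite /D big_seq; elim/big_ind: _ => [|a b da db|a];
    rewrite ?dvdn0 ?dvdn_gcd ?da //.
  by apply: (allP fd).
have Df a : a \in f -> (D %| a)%N by move=> af; rewrite /D (big_rem a af) dvdn_gcdl.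
have D0 : (0 < D)%N.
  by case: (f) sf f0 Df => // a s _ /andP[a0 _] /(_ a (mem_head _ _)); apply: dvdn_gt0.
apply: leq_trans (_ : D * m.+1 <= _)%N; first by rewrite leq_mul2r (dvdn_leq D0 dD).
pose g := [seq (a %/ D)%N | a <- f].
have fg : f = [seq (D * a)%N | a <- g].
  rewrite /g -map_comp -[LHS]map_id; apply/eq_in_map => a /Df /= Da.
  by rewrite mulnC divnK.
have g0 : all (leq 1) g.
  rewrite fg all_map in f0; apply/allP => a /(allP f0) /=.
  by rewrite muln_gt0 => /andP[].
have sg : size g = (0 + m).+1 by rewrite size_map.
have cg e : (1 < e)%N -> (count (dvdn e) g <= m)%N.
  move=> e1; rewrite -ltnS -[X in (_ < X)%N]sg ltn_neqAle count_size andbT -all_count.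
  apply/negP => /allP eg; have : (D * e %| D)%N.
    rewrite {2}/D fg big_map big_seq; elim/big_ind: _ => [|a b da db|a /eg ea].
    - by rewrite dvdn0.
    - by rewrite dvdn_gcd da.
    by rewrite dvdn_pmul2l.
  by move/(dvdn_leq D0); rewrite leqNgt ltn_Pmulr.
move: (npart_diff_asymp g0 sg cg) => Ag.
rewrite leqNgt; apply/negP => lt_mD.
case/andP: xy0 => x0 /andP[y0 _].
pose P := (\prod_(a <- [:: x, y & f]) a)%N; pose Q := (\prod_(a <- g) a)%N.
have PQ : P = (x * y * D ^ m.+1 * Q)%N.
  rewrite /P !big_cons fg big_map big_split /= big_const_seq.
  by rewrite count_predT sg iter_muln_1 !mulnA.
have P0 : (0 < P)%N by rewrite /P big_seq prodn_cond_gt0 // => a /(allP l0).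
have Q0 : (0 < Q)%N by rewrite /Q big_seq prodn_cond_gt0 // => a /(allP g0).
set q := _^-1 in Ag.
pose lam : rat := m.+2%:R / (P * m.+1`!)%N%:R.
pose K : rat := (x * y * D ^ m)%:R.
have K0 : 0 < K by rewrite ltr0n !muln_gt0 x0 y0 expn_gt0 D0.
have gap : K * lam < q.
  have -> : K * lam = q * (m.+2%:R / (D * m.+1)%:R).
    rewrite /K /lam /q PQ factS -/Q expnS !natrM; field.
    by rewrite nat1r !pnatr_eq0 -!lt0n fact_gt0 expn_gt0 D0 Q0 x0 y0.
  have q0 : 0 < q by rewrite invr_gt0 ltr0n muln_gt0 Q0 fact_gt0.
  by rewrite gtr_pMr // ltr_pdivrMr ?mul1r ?ltr_nat // ltr0n muln_gt0 D0.
(* c lies between the leading coefficient that log-concavity allows for the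
   second differences and the one that the partition counts require. *)
pose c := (lam + q / K) / 2%:R.
have lam_c : lam < c.
  have : lam < q / K by rewrite ltr_pdivlMr // mulrC.
  by rewrite /c; lra.
have cK : K * c < q.
  have -> : K * c = (K * lam + q) / 2%:R.
    by rewrite /c mulrA mulrDr [K * (q / K)]mulrC divfK ?lt0r_neq0.
  lra.
pose e := (q - K * c) / 2%:R.
have e0 : 0 < e by rewrite /e; lra.
have [N1 H1] := npart_diff2_bound l0 sz cnt lc lam_c.
have [N2 H2] := asymp_ratio Ag e0.
pose n := (N1 + N2 + x + y).+1.
have n0 : 0 < n%:R ^+ m :> rat by rewrite exprn_gt0 // ltr0n.
have N2n : (N2 <= n)%N by clear; rewrite /n; lia.
have := H2 n N2n; rewrite ler_distl npart_diff0 => /andP[+ _].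
rewrite -(@npart_scale D) // -fg.
have le_xyn : (x + y + N1 <= D * n)%N.
  by apply: leq_trans (leq_pmull n D0); clear; rewrite /n; lia.
have [t Dt] : exists t, (D * n = t + x + y)%N.
  exists (D * n - (x + y))%N; rewrite -addnA subnK //.
  by apply: leq_trans le_xyn; rewrite leq_addr.
have N1t : (N1 <= t)%N by move: le_xyn; rewrite Dt; clear; lia.
suff : ((npart f (D * n))%:Z)%:~R <= K * c * n%:R ^+ m.
  by rewrite -ler_pdivrMr // /e; lra.
rewrite -sum_const_scaled.
rewrite {1}Dt npart_sum_diff2 // rmorph_sum ler_sum //= => i _.
rewrite rmorph_sum ler_sum //= => j _.
have c0 : 0 <= c by apply/ltW/(le_lt_trans _ lam_c); rewrite divr_ge0 ?ler0n.
apply: le_trans (H1 _ _) _; first by rewrite -addnA (leq_trans N1t) ?leq_addr.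
rewrite ler_wpM2l // lerXn2r ?nnegrE // ler_nat Dt.
by rewrite !leq_add // ltnW.
Qed.

Local Close Scope ring_scope.

(** * The exceptional lists and the characterization *)

Lemma npart_ones2 n : npart [:: 1; 1] n = n.+1.
Proof.
elim: n => [|n IHn]; first by rewrite !npart_lt.
by rewrite -(addn1 n) npartD // IHn npart1 // dvd1n !addn1.
Qed.

Lemma log_concave_ones2 : eventually_log_concave (npart [:: 1; 1]).
Proof. by exists 0 => -[|n] // _; rewrite !npart_ones2 /=; nia. Qed.

Lemma npart_12 n : npart [:: 1; 2] n = n./2.+1.
Proof.
elim: n => [|n IHn]; first by rewrite !npart_lt.
by rewrite -(addn1 n) npartD // IHn npart1 // addn1 dvdn2 /= uphalf_half; lia.
Qed.

Lemma npart_112 n : npart [:: 1; 1; 2] n.*2 = n.+1 ^ 2 /\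
  npart [:: 1; 1; 2] n.*2.+1 = n.+1 * n.+2.
Proof.
(* Adding a second part 1 sums the counts n/2 + 1 for the parts 1, 2. *)
have step j : npart [:: 1; 1; 2] j.+1 = npart [:: 1; 1; 2] j + j.+1./2.+1.
  by rewrite -(addn1 j) npartD // npart_12.
have odd_of_even j : npart [:: 1; 1; 2] j.*2 = j.+1 ^ 2 ->
    npart [:: 1; 1; 2] j.*2.+1 = j.+1 * j.+2.
  by move=> E; rewrite step E /= uphalf_double; lia.
suff even : npart [:: 1; 1; 2] n.*2 = n.+1 ^ 2 by split; rewrite ?odd_of_even.
elim: n => [|n /odd_of_even IHn]; first by rewrite double0 !npart_lt.
by rewrite doubleS step IHn -doubleS doubleK; nia.
Qed.

(** The extreme case of [log_concave_gcd]: equality holds in the log-concavity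
    inequality at every odd index. *)
Lemma not_log_concave_112 : ~ eventually_log_concave (npart [:: 1; 1; 2]).
Proof.
case=> N /(_ N.*2.+1); rewrite -doubleS !(proj1 (npart_112 _)).
rewrite (proj2 (npart_112 _)) => /(_ ltac:(lia)); nia.
Qed.

Lemma count_parts (a : nat -> nat) k d :
  count (dvdn d) [seq a i | i <- iota 0 k] = #|[set i : 'I_k | d %| a i]|.
Proof.
rewrite count_map -val_enum_ord count_map -sum1_count big_enum_cond /= -sum1_card.
by apply: eq_bigl => i; rewrite inE.
Qed.

(** A subset of k-2 indices whose parts have a common divisor [d > 1] exists if
    and only if [d] divides at least k-2 parts. *)
Lemma gcd_multisubsetsP (a : nat -> nat) k : (forall i, 0 < a i) -> 3 <= k ->
  (forall A : {set 'I_k}, #|A| = k - 2 -> multisubset_gcd a A = 1) <->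
  (forall d, 1 < d -> count (dvdn d) [seq a i | i <- iota 0 k] <= k - 3).
Proof.
move=> a0 k3; split=> [gcd1 d d1|cnt A cA].
  rewrite count_parts leqNgt; apply/negP => lt_k.
  have /card_geqP[s [us ss sub]] : k - 2 <= #|[set i : 'I_k | d %| a i]| by lia.
  have dgcd : d %| multisubset_gcd a [set i in s].
    rewrite /multisubset_gcd; elim/big_ind: _ => [|x y dx dy|i].
    - by rewrite dvdn0.
    - by rewrite dvdn_gcd dx.
    by rewrite inE => /sub; rewrite inE.
  move: dgcd; rewrite gcd1 ?dvdn1; first by lia.
  by rewrite cardsE (card_uniqP us).
set g := multisubset_gcd a A.
have gA i : i \in A -> g %| a i.
  by move=> iA; rewrite /g /multisubset_gcd (bigD1 i) // dvdn_gcdl.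
have /card_gt0P[i iA] : 0 < #|A| by rewrite cA; lia.
have g0 : 0 < g by apply: dvdn_gt0 (gA i iA).
apply/eqP; rewrite eqn_leq g0 andbT leqNgt; apply/negP => /cnt.
have : #|A| <= #|[set i : 'I_k | g %| a i]|.
  by apply/subset_leq_card/subsetP => j jA; rewrite inE gA.
by rewrite count_parts cA; lia.
Qed.

Theorem corollary5p8 (a : nat -> nat) (k : nat)
  (a_gt0 : forall i : nat, 0 < a i)
  (a_nondecreasing : forall i j : nat, i <= j -> a i <= a j)
  (k_gt0 : 0 < k) :
  eventually_log_concave (fun n => multicolor_p a n k) <->
  (2 <= k /\ (forall i : 'I_k, a i = 1)) \/
  (4 <= k /\
   (forall A : {set 'I_k}, #|A| = k - 2 -> multisubset_gcd a A = 1)).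
Proof.
set l := [seq a i | i <- iota 0 k].
have lc_l : eventually_log_concave (fun n => multicolor_p a n k) <->
    eventually_log_concave (npart l).
  by split=> -[N H]; exists N => n /H; rewrite !multicolor_pE.
have l0 : all (leq 1) l by apply/allP=> _ /mapP[i _ ->].
have sl : size l = k by rewrite size_map size_iota.
have ln0 : l != [::] by rewrite -size_eq0 sl -lt0n.
rewrite {}lc_l; split=> [lc|[[k2 ones]|[k4 /gcd_multisubsetsP cnt]]]; last first.
- by apply: (@npart_log_concave l (k - 3)) => //; [lia | apply: cnt => //; lia].
- have l_ones : l = nseq k 1.
    apply: (@eq_from_nth _ 0); rewrite ?size_nseq sl // => i lt_ik.
    rewrite (nth_map 0) ?size_iota // nth_iota // nth_nseq lt_ik.
    by rewrite (ones (Ordinal lt_ik)).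
  rewrite l_ones; case: k k2 {k_gt0 ones l l0 sl ln0 l_ones} => [|[|[|m]]] // _.
    exact: log_concave_ones2.
  apply: (@npart_log_concave _ m); rewrite ?size_nseq ?all_nseq // => d d1.
  by rewrite count_nseq dvdn1 gtn_eqF.
have two d : 1 < d -> 1 < count (predC (dvdn d)) l.
  by move=> d1; apply: log_concave_two_ndvd.
have cntC d : count (dvdn d) l + count (predC (dvdn d)) l = k by rewrite count_predC.
have k2 : 2 <= k by have := two 2 isT; have := cntC 2; lia.
case: (boolP [forall i : 'I_k, a i == 1]) => [/forallP ones|].
  by left; split=> // i; apply/eqP.
case/forallPn => i0 ai0; have ai1 : 1 < a i0 by have := a_gt0 i0; lia.
have cnt_ai : 0 < count (dvdn (a i0)) l.
  by rewrite count_parts; apply/card_gt0P; exists i0; rewrite inE.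
have k3 : 3 <= k by have := two _ ai1; have := cntC (a i0); lia.
have cnt d : 1 < d -> count (dvdn d) l <= (k - 3).+1.
  by move=> d1; have := two d d1; have := cntC d; lia.
have sl3 : size l = (k - 3).+3 by lia.
have tight d : 1 < d -> count (dvdn d) l = (k - 3).+1 -> d * (k - 3).+1 <= (k - 3).+2.
  exact: log_concave_gcd.
right; case: (ltnP 3 k) => [k4|le_k3].
  split=> //; apply/gcd_multisubsetsP => // d d1.
  have := cnt d d1; rewrite leq_eqVlt => /orP[/eqP/(tight d d1)|//].
  by move: d1 k4; clear; nia.
have {k3 le_k3}k3 : k = 3 by lia.
suff l112 : l = [:: 1; 1; 2] by rewrite l112 in lc; case: (not_log_concave_112 lc).
have a2_gt1 : 1 < a 2.
  by apply: leq_trans ai1 _; apply: a_nondecreasing; have := ltn_ord i0; lia.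
move: cnt tight; rewrite /l k3 /= => cnt tight.
have a2 : a 2 = 2.
  have := tight _ a2_gt1; have := cnt _ a2_gt1; rewrite dvdnn; lia.
have := cnt 2 isT; rewrite a2 /=.
have := a_gt0 0; have := a_gt0 1.
have := a_nondecreasing 0 2 isT; have := a_nondecreasing 1 2 isT; rewrite a2.
by case: (a 0) (a 1) => [|[|[|?]]] [|[|[|?]]].
Qed.
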